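(* Suppose each $f_i$ is $\mu$-strongly convex and $L$-smooth with $\mu>0$, and that $W$ is a weight matrix as described in the context. Run EXTRA with $\beta=L$, $\alpha=\frac{1}{2(L+\beta)}$, $v^0=0$ and initial point $x^0$. Then EXTRA needs $$O\left(\left(\frac{L}{\mu}+\frac{1}{1-\sigma_2(W)}\right)\log\frac{LR_1+R_2/L}{\epsilon(1-\sigma_2(W))}\right)$$ iterations to achieve an $\epsilon$-optimal solution $x$ (an iterate $x^k$) such that $$F(\alpha(x))-F(x^* )\le\epsilon\quad\text{and}\quad\frac1m\sum_{i=1}^m\left\|x_{(i)}-\alpha(x)\right\|^2\le\epsilon^2 .$$
   Context: Setting: $m$ agents form an undirected network; $f_1,\dots,f_m:\mathbb{R}^n\to\mathbb{R}$ are differentiable, and $F(x)=\frac1m\sum_{i=1}^m f_i(x)$ with minimizer $x^*$. $f_i$ is $\mu$-strongly convex if $f_i(y)\ge f_i(x)+\langle\nabla f_i(x),y-x\rangle+\frac{\mu}{2}\|y-x\|^2$ for all $x,y$, and $L$-smooth if $f_i(y)\le f_i(x)+\langle\nabla f_i(x),y-x\rangle+\frac{L}{2}\|y-x\|^2$ for all $x,y$. For $x\in\mathbb{R}^{m\times n}$ with rows $x_{(1)}^T,\dots,x_{(m)}^T$, put $f(x)=\sum_{i} f_i(x_{(i)})$, let $\nabla f(x)\in\mathbb{R}^{m\times n}$ have rows $\nabla f_i(x_{(i)})^T$, and let $\alpha(x)=\frac1m\sum_i x_{(i)}$ (not to be confused with the step-size $\alpha$). Weight matrix: $W\in\mathbb{R}^{m\times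 m}$ with $W_{i,j}\ne0$ if and only if agents $i,j$ are neighbors or $i=j$; $W=W^T$, $I\succeq W\succeq -I$, $W\mathbf{1}=\mathbf{1}$; and $\sigma_2(W)<1$, where $\sigma_2(W)$ is the second largest singular value of $W$. EXTRA with parameters $\alpha,\beta>0$ and input $x^0,v^0\in\mathbb{R}^{m\times n}$ iterates $$x^{k+1}=x^k-\alpha\left(\nabla f(x^k)+v^k+\tfrac{\beta}{2}(I-W)x^k\right),\qquad v^{k+1}=v^k+\tfrac{\beta}{2}(I-W)x^{k+1}.$$ $R_1,R_2>0$ are constants with $\|x_{(i)}^0-x^*\|^2\le R_1$, $\|x^*\|^2\le R_1$, $\|\nabla f_i(x^* )\|^2\le R_2$ for all $i$. Meaning of $O(\cdot)$: $R_1,R_2$ are regarded as constants. There are $C>0$ and $\epsilon_0>0$ depending only on $R_1,R_2$ such that for all $0<\epsilon\le\epsilon_0$ the two inequalities hold for $x=x^k$ for every $k$ at least $C$ times the displayed expression. *)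

(* Defs.v *)
From mathcomp Require Import all_boot all_order all_algebra.
From mathcomp Require Import all_classical all_reals all_analysis.
From mathcomp Require polyrcf.

Set Implicit Arguments.
Unset Strict Implicit.
Unset Printing Implicit Defensive.

Import Order.TTheory GRing.Theory Num.Theory.
Import numFieldNormedType.Exports.
Local Open Scope ring_scope.

(* Points of R^n are row vectors. The library norm on 'rV[R]_n is the sup norm,
   hence the explicit Euclidean structure below. *)

Definition inner (R : realType) n (u v : 'rV[R]_n) : R :=
  \sum_(j < n) u 0 j * v 0 j.

Definition enorm (R : realType) n (u : 'rV[R]_n) : R := Num.sqrt (inner u u).

Definition grad (R : realType) n (f : 'rV[R]_n -> R) (x : 'rV[R]_n) : 'rV[R]_n :=
  \row_(j < n) 'D_(delta_mx 0 j) f x.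

Definition strongly_convex (R : realType) n (mu : R) (f : 'rV[R]_n -> R) : Prop :=
  forall x y : 'rV[R]_n,
    f x + inner (grad f x) (y - x) + mu / 2 * enorm (y - x) ^+ 2 <= f y.

Definition smooth (R : realType) n (L : R) (f : 'rV[R]_n -> R) : Prop :=
  forall x y : 'rV[R]_n,
    f y <= f x + inner (grad f x) (y - x) + L / 2 * enorm (y - x) ^+ 2.

Definition avg_fun (R : realType) m n (f : 'I_m -> 'rV[R]_n -> R)
    (x : 'rV[R]_n) : R :=
  m%:R^-1 * \sum_(i < m) f i x.

Definition minimizer (R : realType) n (F : 'rV[R]_n -> R) (xs : 'rV[R]_n) : Prop :=
  forall y : 'rV[R]_n, F xs <= F y.

Definition avg_row (R : realType) m n (x : 'M[R]_(m, n)) : 'rV[R]_n :=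
  m%:R^-1 *: \sum_(i < m) row i x.

Definition stacked_grad (R : realType) m n (f : 'I_m -> 'rV[R]_n -> R)
    (x : 'M[R]_(m, n)) : 'M[R]_(m, n) :=
  \matrix_(i < m) grad (f i) (row i x).

Definition psd (R : realType) m (A : 'M[R]_m) : Prop :=
  A^T = A /\ forall u : 'rV[R]_m, 0 <= (u *m A *m u^T) 0 0.

(* The real eigenvalues of A, each repeated according to its algebraic
   multiplicity. *)
Definition real_eigenvalues (R : realType) m (A : 'M[R]_m) : seq R :=
  flatten [seq nseq (mup a (char_poly A)) a
          | a <- polyrcf.rootsR (char_poly A)].

Definition singular_values (R : realType) m (A : 'M[R]_m) : seq R :=
  sort (fun a b : R => b <= a)
    [seq Num.sqrt a | a <- real_eigenvalues (A^T *m A)].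

(* For a 1 x 1 matrix there is no second singular value; the value is then 0. *)
Definition sigma2 (R : realType) m (A : 'M[R]_m) : R :=
  nth 0 (singular_values A) 1.

(* [e i j] holds when agents i and j are distinct neighbors. *)
Record weight_matrix (R : realType) m (e : rel 'I_m) (W : 'M[R]_m) : Prop :=
  WeightMatrix {
    weight_support : forall i j : 'I_m, (W i j != 0) = e i j || (i == j);
    weight_sym : W^T = W;
    weight_le1 : psd (1%:M - W);
    weight_geN1 : psd (W + 1%:M);
    weight_const : W *m const_mx 1 = const_mx 1 :> 'cV[R]_m;
    weight_sigma2 : sigma2 W < 1
  }.

Definition extra_step (R : realType) m n (f : 'I_m -> 'rV[R]_n -> R)
    (W : 'M[R]_m) (alpha beta : R) (xv : 'M[R]_(m, n) * 'M[R]_(m, n)) :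
    'M[R]_(m, n) * 'M[R]_(m, n) :=
  let: (x, v) := xv in
  let x' := x - alpha *: (stacked_grad f x + v
                          + (beta / 2) *: ((1%:M - W) *m x)) in
  (x', v + (beta / 2) *: ((1%:M - W) *m x')).

Definition extra (R : realType) m n (f : 'I_m -> 'rV[R]_n -> R)
    (W : 'M[R]_m) (alpha beta : R) (x0 v0 : 'M[R]_(m, n)) (k : nat) :
    'M[R]_(m, n) * 'M[R]_(m, n) :=
  iter k (extra_step f W alpha beta) (x0, v0).

(* Main.v *)
Require Import Defs.
From mathcomp Require Import all_boot all_order all_algebra.
From mathcomp Require Import all_classical all_reals all_analysis.
From mathcomp Require polyrcf.
From mathcomp Require Import ring lra.

Import Order.TTheory GRing.Theory Num.Theory.
Import numFieldNormedType.Exports.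
Local Open Scope ring_scope.

(* Put [B = (L / 2) (1 - W)], and let [v_star = - grad f (x_star)] be the limit of
   the dual variable. It has zero column sums, so it lies in the range of [B] and
   [v = v_star + B y] for a potential [y] with [y' = y + (x' - x_star)]. With
   [M = 4 L - B], one step is [M (x' - x) = - (g + B y')], where
   [g = grad f (x) - grad f (x_star)], and
   [V = <x - x_star, M (x - x_star)> + <y, B y>] decreases by
   [<d, M d> + <x' - x_star, B (x' - x_star)> + 2 <x' - x_star, g>], [d = x' - x].
   Strong convexity and cocoercivity bound the last term below by
   [mu |x' - x_star|^2 + |g|^2 / L - L |d|^2], while the spectral gap of [W] bounds
   [<y', B y'>] by a multiple of [|B y'|^2 = |g + M d|^2]. Hence [V] contracts by
   the factor [1 / (1 + rate)]. *)

(** * Geometric and algebraic multiplicity of eigenvalues *)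

Section GeometricMultiplicity.
Context {F : fieldType} {n : nat}.
Implicit Types (A : 'M[F]_n) (a : F).

(** In a basis whose first [r] rows span the eigenspace, [('X - a) ^ r] factors out of the
    determinant of the characteristic matrix. *)
Lemma rank_eigenspace_mup A a :
  (\rank (eigenspace A a) <= mup a (char_poly A))%N.
Proof.
set V := eigenspace A a; set r := \rank V.
have ch0 : char_poly A != 0 by rewrite monic_neq0 ?char_poly_monic.
rewrite mup_geq //.
pose P := row_ebase V.
have rowE (i : 'I_n) : (i < r)%N -> row i P *m A = a *: row i P.
  move=> ir; apply/eigenspaceP.
  (* In [V = col_ebase V *m pid_mx r *m P], the factor [pid_mx r] keeps exactly the first [r] rows
     of [P], so these lie in the row space of [V]. *)
  have -> : row i P = row i (invmx (col_ebase V) *m V).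
    rewrite -{2}(mulmx_ebase V) -mulmxA mulKmx ?col_ebase_unit //.
    apply/rowP => j; rewrite !mxE (bigD1 i) //= big1 => [|k ki].
      by rewrite !mxE eqxx ir mul1r addr0.
    by rewrite !mxE eq_sym val_eqE (negbTE ki) mul0r.
  by rewrite (submx_trans (row_sub _ _)) // submxMl.
(* The first [r] rows of [P (X - A)] are [X - a] times those of [P]. *)
pose PX : 'M[{poly F}]_n := map_mx polyC P.
pose d : 'rV[{poly F}]_n := \row_i (if (i < r)%N then 'X - a%:P else 1).
pose Q : 'M[{poly F}]_n := \matrix_(i, j)
  (if (i < r)%N then PX i j else (PX *m char_poly_mx A) i j).
have E : PX *m char_poly_mx A = diag_mx d *m Q.
  apply/matrixP => i j; rewrite mul_diag_mx [RHS]mxE [Q i j]mxE [d 0 i]mxE.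
  case: ifP => ir; last by rewrite mul1r.
  rewrite /char_poly_mx mulmxBr mul_mx_scalar -map_mxM.
  have PAij : (P *m A) i j = a * P i j.
    by have /rowP/(_ j) := rowE _ ir; rewrite -row_mul mxE => ->; rewrite !mxE.
  rewrite mxE [X in _ + X]mxE [X in - X]mxE PAij !mxE rmorphM; ring.
have := congr1 determinant E; rewrite !det_mulmx det_diag.
have -> : \prod_i d 0 i = ('X - a%:P) ^+ r.
  rewrite (eq_bigr (fun i : 'I_n => if (i < r)%N then 'X - a%:P else 1)); last first.
    by move=> i _; rewrite mxE.
  rewrite -big_mkcond /= (big_ord_narrow (rank_leq_col V)) /=.
  by rewrite prodr_const card_ord.
rewrite /PX det_map_mx => E'.
have dP : \det P != 0 by rewrite -unitfE -unitmxE row_ebase_unit.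
by rewrite -(dvdpZr _ _ dP) -mul_polyC /char_poly E' dvdp_mulr.
Qed.
End GeometricMultiplicity.

(** * Euclidean inner product and the Rayleigh quotient *)

Section Inner.
Context {R : realType} {n : nat}.
Implicit Types (u v w : 'rV[R]_n) (a : R).

Lemma innerC u v : inner u v = inner v u.
Proof. by apply: eq_bigr => j _; rewrite mulrC. Qed.
Lemma innerDl u v w : inner (u + v) w = inner u w + inner v w.
Proof. by rewrite -big_split; apply: eq_bigr => j _; rewrite mxE mulrDl. Qed.
Lemma innerZl a u w : inner (a *: u) w = a * inner u w.
Proof. by rewrite mulr_sumr; apply: eq_bigr => j _; rewrite mxE mulrA. Qed.
Lemma innerDr u v w : inner w (u + v) = inner w u + inner w v.
Proof. by rewrite innerC innerDl !(innerC w). Qed.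
Lemma innerZr a u w : inner w (a *: u) = a * inner w u.
Proof. by rewrite innerC innerZl innerC. Qed.
Lemma innerNl u w : inner (- u) w = - inner u w.
Proof. by rewrite -scaleN1r innerZl mulN1r. Qed.
Lemma innerNr u w : inner w (- u) = - inner w u.
Proof. by rewrite innerC innerNl innerC. Qed.
Lemma inner_ge0 u : 0 <= inner u u.
Proof. by apply: sumr_ge0 => j _; rewrite -expr2 sqr_ge0. Qed.
Lemma inner_eq0 u : (inner u u == 0) = (u == 0).
Proof.
apply/eqP/eqP => [|->]; last by rewrite /inner big1 // => j _; rewrite mxE mul0r.
move=> /psumr_eq0P H; apply/rowP => j; rewrite mxE; apply/eqP.
rewrite -sqrf_eq0 expr2; apply/eqP; apply: H => // i _.
by rewrite -expr2 sqr_ge0.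
Qed.
Lemma enorm_sqr u : enorm u ^+ 2 = inner u u.
Proof. by rewrite sqr_sqrtr // inner_ge0. Qed.
Lemma inner_trE u v : inner u v = (u *m v^T) 0 0.
Proof. by rewrite mxE; apply: eq_bigr => j _; rewrite !mxE. Qed.

Lemma inner0l u : inner 0 u = 0.
Proof. by rewrite -(scale0r 0) innerZl mul0r. Qed.
Lemma inner0r u : inner u 0 = 0.
Proof. by rewrite innerC inner0l. Qed.
Lemma inner_ones : inner (const_mx 1 : 'rV[R]_n) (const_mx 1) = n%:R.
Proof.
rewrite /inner (eq_bigr (fun=> 1)); first by rewrite sumr_const card_ord.
by move=> i _; rewrite !mxE mulr1.
Qed.

Lemma inner_suml (I : finType) (v : I -> 'rV[R]_n) w :
  inner (\sum_i v i) w = \sum_i inner (v i) w.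
Proof.
apply: (big_morph (fun u => inner u w)) => [u u'|]; first exact: innerDl.
exact: inner0l.
Qed.

Definition innerE := (innerDl, innerDr, innerNl, innerNr, innerZl, innerZr).

Lemma inner_mulmx u v (A : 'M[R]_n) : inner (u *m A) v = inner u (v *m A^T).
Proof. by rewrite !inner_trE trmx_mul trmxK mulmxA. Qed.

Lemma inner_continuous (A : 'M[R]_n) :
  continuous (fun v : 'rV[R]_n => inner v (v *m A)).
Proof.
rewrite /inner; apply: (continuous_big add_continuous) => j _ v.
have -> : (fun w : 'rV[R]_n => w 0 j * (w *m A) 0 j) =
    (fun w => w 0 j * \sum_k w 0 k * A k j) by apply/funext => w; rewrite [X in _ * X]mxE.
apply: (continuousM (@coord_continuous R 1 n 0 j v)).
apply: (continuous_big add_continuous) => k _ w.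
apply: (continuousM (@coord_continuous R 1 n 0 k w)); exact: cst_continuous.
Qed.

(** The Rayleigh quotient attains its maximum on the compact unit sphere, and a maximiser is an
    eigenvector. *)
Lemma max_eigenvalue (A : 'M[R]_n) : (0 < n)%N -> A^T = A ->
  exists (lam : R) (c : 'rV[R]_n), [/\ c != 0, c *m A = lam *: c &
    forall v, inner v (v *m A) <= lam * inner v v].
Proof.
move=> n0 symA.
(* The factor [1%:M] lets [inner_continuous] give the closedness of the sphere. *)
pose S : set 'rV[R]_n := [set v | inner v (v *m 1%:M) = 1]%classic.
have SE v : S v <-> inner v v = 1 by rewrite /S /= mulmx1.
have S0 : (S !=set0)%classic.
  exists (delta_mx 0 (Ordinal n0)); apply/SE.
  rewrite /inner (bigD1 (Ordinal n0)) //= big1 => [|i ii].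
    by rewrite !mxE !eqxx mulr1 addr0.
  by rewrite !mxE (negbTE ii) andbF mul0r.
have Sco : compact S.
  apply: bounded_closed_compact.
    exists (1 : R); split; first exact: num_real.
    move=> M M1 v /SE Sv; apply: (le_trans _ (ltW M1)).
    rewrite [leLHS]/Num.norm /= mx_normrE; apply/bigmax_leP; split => // -[i j] _ /=.
    rewrite ord1 -(@ler_pXn2r _ 2) ?nnegrE // expr1n -normrX ger0_norm ?sqr_ge0 //.
    rewrite -Sv /inner (bigD1 j) //= expr2 lerDl.
    by apply: sumr_ge0 => k _; rewrite -expr2 sqr_ge0.
  apply: (@preimage_closed _ _ (fun v : 'rV[R]_n => inner v (v *m 1%:M)) [set 1]%classic).
    by move=> v _; exact: inner_continuous.
  exact: closed_eq.
have [c cS cmax] : exists2 c, c \in S & forall t, t \in S ->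
    inner t (t *m A) <= inner c (c *m A).
  apply: EVT_max_rV => //; apply: continuous_subspaceT; exact: inner_continuous.
have c1 : inner c c = 1 by apply/SE; move: cS; rewrite inE.
set lam := inner c (c *m A) in cmax.
have H v : inner v (v *m A) <= lam * inner v v.
  have [->|v0] := eqVneq v 0; first by rewrite !inner0l mulr0.
  have vp : 0 < inner v v by rewrite lt_neqAle inner_ge0 eq_sym inner_eq0 v0.
  set s := Num.sqrt (inner v v).
  have s0 : 0 < s by rewrite sqrtr_gt0.
  have ss : s * s = inner v v by rewrite -expr2 sqr_sqrtr ?ltW.
  have sS : s^-1 *: v \in S.
    by rewrite inE; apply/SE; rewrite !innerE -ss; field; rewrite gt_eqF.
  have := cmax _ sS.
  by rewrite -scalemxAl !innerE mulrA -invfM ss mulrC ler_pdivrMr.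
exists lam, c; split => //; first by rewrite -inner_eq0 c1 oner_eq0.
(* The nonnegative form [lam |v|^2 - <v, v A>] vanishes at [c], so its gradient
   [w] at [c] must vanish: compare with its value at [c - t w]. *)
have [w wE] : exists w, w = lam *: c - c *m A by exists (lam *: c - c *m A).
suff : w == 0 by rewrite wE subr_eq0 => /eqP.
rewrite -inner_eq0.
set b := lam * inner w w - inner w (w *m A).
have b0 : 0 <= b by rewrite subr_ge0.
have K t : 0 <= - 2 * t * inner w w + t ^+ 2 * b.
  have := H (c - t *: w).
  have E1 : inner c (w *m A) = inner w (c *m A).
    by rewrite -[in RHS]symA -inner_mulmx innerC.
  rewrite mulmxBl -scalemxAl !innerE E1 (innerC w c) c1 -/lam /b.
  have : inner w w = lam * inner c w - inner w (c *m A).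
    by rewrite (innerC c w) -innerZr -innerNr -innerDr -wE.
  move=> E2 E3.
  have : 0 <= lam * (1 - t * inner c w - t * (inner c w - t * inner w w)) -
    (lam - t * inner w (c *m A) - t * (inner w (c *m A) - t * inner w (w *m A))).
    lra.
  rewrite {2}E2; lra.
have a0 := inner_ge0 w.
rewrite eq_le a0 andbT leNgt; apply/negP => ap.
(* For this [t], [t * b <= inner w w], so the right side of [K] is at most [- t * inner w w < 0];
   the [+ 1] covers [b = 0]. *)
have := K (inner w w / (b + 1)).
set t := _ / _.
have tp : 0 < t by rewrite divr_gt0 //; lra.
have tb : t * b <= inner w w.
  rewrite /t mulrAC ler_pdivrMr; last lra.
  by rewrite ler_pM2l //; lra.
nra.
Qed.
End Inner.

(** * The second singular value as a bound on the complement of the constants *)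

Section SpectralGap.
Context {R : realType}.

(** [sigma2] reads entry 1 of the decreasing list, so two singular values above [t], counted with
    multiplicity, bound it from below. *)
Lemma nth1_sort_ge (s : seq R) (t : R) :
  (1 < count (>= t)%R s)%N ->
  t <= nth 0 (sort (fun a b : R => b <= a) s) 1.
Proof.
rewrite -(count_sort (fun a b : R => b <= a)).
have : sorted (fun a b : R => b <= a) (sort (fun a b : R => b <= a) s).
  by apply: sort_sorted => a b; exact: le_total.
case: (sort _ s) => [|x [|y l]] //=; first by case: (t <= x).
case/andP => _ yl; case: (leP t y) => // yt.
rewrite (_ : count _ l = 0%N) ?addn0 ?add0n; first by case: (t <= x).
apply/eqP; rewrite -leqn0 leqNgt -has_count; apply/hasPn => z zl.
rewrite -ltNge; apply: le_lt_trans yt.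
have trans : transitive (fun a b : R => b <= a) by move=> a b c ab bc; exact: le_trans bc ab.
by have /allP := order_path_min trans yl; apply.
Qed.

Lemma count_real_eigenvalues {m} (A : 'M[R]_m) a :
  count_mem a (real_eigenvalues A) = mup a (char_poly A).
Proof.
have p0 : char_poly A != 0 by rewrite monic_neq0 ?char_poly_monic.
rewrite count_flatten -map_comp sumnE big_map.
rewrite (eq_bigr (fun b => (b == a) * mup b (char_poly A))%N); last first.
  by move=> b _; rewrite /= count_nseq.
have [ra|nra] := boolP (root (char_poly A) a); last first.
  rewrite mupNroot // big1_seq // => b /andP[_]; rewrite -polyrcf.roots_on_rootsR // => /andP[_ rb].
  by case: eqVneq => // ba; move: nra; rewrite -ba rb.
have ar : a \in polyrcf.rootsR (char_poly A).
  by rewrite -polyrcf.roots_on_rootsR // ra inE.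
rewrite (bigD1_seq a) ?polyrcf.uniq_roots //= eqxx mul1n big1 ?addn0 //.
by move=> b /negbTE ->.
Qed.

Lemma sigma2_ge0 {m} (W : 'M[R]_m) : 0 <= sigma2 W.
Proof.
rewrite /sigma2 /singular_values.
have [h|h] := ltnP 1 (size (sort (fun a b : R => b <= a)
    [seq Num.sqrt a | a <- real_eigenvalues (W^T *m W)])); last by rewrite nth_default.
have := mem_nth 0 h; rewrite mem_sort => /mapP[a _ ->]; exact: sqrtr_ge0.
Qed.

(** The constants and an orthogonal eigenvector of [W] for [lam > 0] are eigenvectors of [W^T W] for
    [1] and [lam ^+ 2]. As [lam <= 1], two singular values are at least [lam]. *)
Lemma sigma2_gap {m e} (W : 'M[R]_m) (u : 'rV[R]_m) : (0 < m)%N -> weight_matrix e W ->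
  inner u (const_mx 1) = 0 -> inner u (u *m W) <= sigma2 W * inner u u.
Proof.
move=> m0 [_ symW [_ le1] _ W1 s1] uo.
set ones : 'rV[R]_m := const_mx 1.
have oW : ones *m W = ones by rewrite -[W]symW -[ones]trmxK -trmx_mul trmx_const W1 trmx_const.
have oo : inner ones ones = m%:R by exact: inner_ones.
have mn0 : m%:R != 0 :> R by rewrite pnatr_eq0 -lt0n.
(* Removing the eigenvalue 1 of the constants makes the maximiser of the
   Rayleigh quotient of [A] orthogonal to them when it is positive. *)
pose A := W - m%:R^-1 *: (ones^T *m ones).
have vA (v : 'rV[R]_m) : v *m A = v *m W - (m%:R^-1 * inner v ones) *: ones.
  rewrite mulmxBr -scalemxAr mulmxA; congr (_ - _); rewrite -scalerA; congr (_ *: _).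
  by rewrite [v *m ones^T]mx11_scalar mul_scalar_mx inner_trE.
have symA : A^T = A by rewrite linearB /= linearZ /= trmx_mul trmxK symW.
have [lam [c [c0 cA maxA]]] := max_eigenvalue A m0 symA.
have uA : inner u (u *m W) <= lam * inner u u.
  by have := maxA u; rewrite vA uo mulr0 scale0r subr0.
apply: le_trans uA _; apply: ler_wpM2r; first exact: inner_ge0.
have [l0|l0] := leP lam 0; first exact: le_trans l0 (sigma2_ge0 W).
have co : inner c ones = 0.
  have : inner (c *m A) ones = 0.
    by rewrite inner_mulmx symA vA oW oo mulVf // scale1r subrr inner0r.
  by rewrite cA innerZl => /eqP; rewrite mulf_eq0 gt_eqF //= => /eqP.
have cW : c *m W = lam *: c by move: cA; rewrite vA co mulr0 scale0r subr0.
have cc : 0 < inner c c by rewrite lt_neqAle inner_ge0 eq_sym inner_eq0 c0.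
have lam1 : lam <= 1.
  have := le1 c; rewrite -inner_trE mulmxBr mulmx1 cW !innerE; nra.
set B := W^T *m W.
have oB : (ones <= eigenspace B 1)%MS.
  by apply/eigenspaceP; rewrite /B symW mulmxA !oW scale1r.
have cB : (c <= eigenspace B (lam ^+ 2))%MS.
  by apply/eigenspaceP; rewrite /B symW mulmxA cW -scalemxAl cW scalerA expr2.
have o0 : ones != 0 by rewrite -inner_eq0 oo.
rewrite /sigma2 /singular_values; apply: nth1_sort_ge; rewrite count_map.
have mo : (0 < mup 1 (char_poly B))%N.
  by apply: leq_trans (rank_eigenspace_mup B 1); apply: leq_trans (mxrankS oB); rewrite rank_rV o0.
have mc : (0 < mup (lam ^+ 2) (char_poly B))%N.
  apply: leq_trans (rank_eigenspace_mup B _).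
  by apply: leq_trans (mxrankS cB); rewrite rank_rV c0.
have P1 : lam <= Num.sqrt (1 : R) by rewrite sqrtr1.
have Pl : lam <= Num.sqrt (lam ^+ 2) by rewrite sqrtr_sqr gtr0_norm.
(* If [lam = 1] the two eigenvalues coincide and the eigenspace must have dimension at least two,
   since otherwise [c] would be a multiple of [ones]. If not, the two multiplicities add up. *)
have [l1|l1] := eqVneq lam 1.
  apply: (@leq_trans (count_mem 1 (real_eigenvalues B))); last first.
    by apply: sub_count => a /= /eqP ->.
  rewrite count_real_eigenvalues; apply: leq_trans (rank_eigenspace_mup B 1).
  rewrite ltnNge; apply/negP => r1.
  have ro : \rank ones = 1%N by rewrite rank_rV o0.
  have [le_r eq_r] := mxrank_leqif_sup oB.
  have : (eigenspace B 1 <= ones)%MS by rewrite -eq_r eqn_leq le_r ro r1.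
  rewrite l1 expr1n in cB => /(submx_trans cB)/sub_rVP[a ca].
  move: co cc; rewrite ca !innerE oo => /eqP; rewrite mulf_eq0 (negbTE mn0) orbF => /eqP ->.
  by rewrite mul0r ltxx.
have l21 : lam ^+ 2 != 1.
  by rewrite sqrf_eq1 negb_or l1 /= gt_eqF //; lra.
apply: (@leq_trans (count (predU (pred1 1) (pred1 (lam ^+ 2))) (real_eigenvalues B))); last first.
  by apply: sub_count => a /= /orP[] /eqP ->.
have := count_predUI (pred1 1) (pred1 (lam ^+ 2)) (real_eigenvalues B).
rewrite (@eq_count _ (predI _ _) pred0); last first.
  by move=> a /=; case: eqP => // ->; rewrite eq_sym (negbTE l21).
rewrite count_pred0 addn0 => ->; rewrite !count_real_eigenvalues.
exact: (leq_add mo mc).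
Qed.
End SpectralGap.

(** * Inequalities for smooth strongly convex functions *)

Section SmoothConvex.
Context {R : realType} {n : nat} (f : 'rV[R]_n -> R) (mu L : R).
Hypotheses (mu0 : 0 < mu) (L0 : 0 < L).
Hypotheses (scf : strongly_convex mu f) (smf : smooth L f).

(** With [D = grad f y - grad f x], the convexity bound from [x] and the smoothness bound from [y]
    are compared at [y - D / L]. *)
Lemma gradient_gap x y :
  f x + inner (grad f x) (y - x)
    + (2 * L)^-1 * inner (grad f y - grad f x) (grad f y - grad f x) <= f y.
Proof.
have [D DE] : exists D, D = grad f y - grad f x by exists (grad f y - grad f x).
have := smf y (y - L^-1 *: D); have := scf x (y - L^-1 *: D); rewrite -DE.
have : 0 <= mu / 2 * enorm (y - L^-1 *: D - x) ^+ 2.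
  by rewrite mulr_ge0 ?sqr_ge0 // ltW // divr_gt0.
move: (mu / 2 * _) => c c0.
rewrite enorm_sqr (addrAC _ _ (- y)) subrr sub0r (addrAC y) (innerDr (y - x)).
rewrite !(innerNl, innerNr, innerZl, innerZr).
have -> : L / 2 * - - (L^-1 * (L^-1 * inner D D)) = (2 * L)^-1 * inner D D.
  by field; rewrite gt_eqF.
have -> : L^-1 = 2 * (2 * L)^-1 by field; rewrite gt_eqF.
have : inner D D = inner (grad f y) D - inner (grad f x) D by rewrite {1}DE innerDl innerNl.
move: (inner D D) => G -> ; lra.
Qed.

(** Smoothness from [x] to [x'], strong convexity from [xs] to [x'] and [gradient_gap] from [x] to
    [xs] are added; all function values cancel. *)
Lemma descent_bound x x' xs :
  mu * inner (x' - xs) (x' - xs)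
    + L^-1 * inner (grad f x - grad f xs) (grad f x - grad f xs)
    - L * inner (x' - x) (x' - x) <=
  2 * inner (x' - xs) (grad f x - grad f xs).
Proof.
have := smf x x'; have := scf xs x'; have := gradient_gap x xs.
rewrite !enorm_sqr.
have -> : inner (grad f xs - grad f x) (grad f xs - grad f x) =
    inner (grad f x - grad f xs) (grad f x - grad f xs).
  by rewrite -opprB innerNl innerNr opprK.
have -> : (2 * L)^-1 = 2^-1 * L^-1 by rewrite invfM.
have -> : inner (x' - xs) (grad f x - grad f xs) =
  inner (grad f x) (x' - x) - inner (grad f x) (xs - x) - inner (grad f xs) (x' - xs).
  by rewrite !innerE !(innerC x') !(innerC xs); ring.
lra.
Qed.
End SmoothConvex.

(** * Frobenius inner product *)

Section Frobenius.
Context {R : realType} {m n : nat}.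
Implicit Types (X Y Z : 'M[R]_(m, n)) (A : 'M[R]_m).

Definition fdot X Y : R := \sum_(i < m) inner (row i X) (row i Y).

Lemma fdotC X Y : fdot X Y = fdot Y X.
Proof. by apply: eq_bigr => i _; rewrite innerC. Qed.
Lemma fdotDl X Y Z : fdot (X + Y) Z = fdot X Z + fdot Y Z.
Proof. by rewrite -big_split; apply: eq_bigr => i _; rewrite linearD innerDl. Qed.
Lemma fdotZl a X Z : fdot (a *: X) Z = a * fdot X Z.
Proof. by rewrite mulr_sumr; apply: eq_bigr => i _; rewrite linearZ innerZl. Qed.
Lemma fdotDr X Y Z : fdot Z (X + Y) = fdot Z X + fdot Z Y.
Proof. by rewrite fdotC fdotDl !(fdotC Z). Qed.
Lemma fdotZr a X Z : fdot Z (a *: X) = a * fdot Z X.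
Proof. by rewrite fdotC fdotZl fdotC. Qed.
Lemma fdotNl X Z : fdot (- X) Z = - fdot X Z.
Proof. by rewrite -scaleN1r fdotZl mulN1r. Qed.
Lemma fdotNr X Z : fdot Z (- X) = - fdot Z X.
Proof. by rewrite fdotC fdotNl fdotC. Qed.
Lemma fdot_ge0 X : 0 <= fdot X X.
Proof. by apply: sumr_ge0 => i _; exact: inner_ge0. Qed.

Definition fdotE := (fdotDl, fdotDr, fdotNl, fdotNr, fdotZl, fdotZr).

(** Gradients act on rows, but left multiplication by [W] acts on columns; this form transfers
    vector inequalities for [W] column by column. *)
Lemma fdot_trE X Y : fdot X Y = \sum_(j < n) inner (row j X^T) (row j Y^T).
Proof.
rewrite /fdot /inner exchange_big; apply: eq_bigr => j _; apply: eq_bigr => i _.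
by rewrite !mxE.
Qed.

Lemma row_tr_mulmx A X j : row j (A *m X)^T = row j X^T *m A^T.
Proof. by rewrite trmx_mul row_mul. Qed.

Lemma fdot_mulmx A X Y : A^T = A -> fdot (A *m X) Y = fdot X (A *m Y).
Proof.
move=> symA; rewrite !fdot_trE; apply: eq_bigr => j _.
by rewrite !row_tr_mulmx inner_mulmx !symA.
Qed.

Lemma psd_fdot A X : psd A -> 0 <= fdot X (A *m X).
Proof.
move=> [symA pA]; rewrite fdot_trE; apply: sumr_ge0 => j _.
rewrite row_tr_mulmx symA innerC inner_trE. exact: pA.
Qed.
End Frobenius.

(** * One-step contraction of the Lyapunov function *)

Section Lyapunov.
Context {R : realType} {m n : nat}.
Implicit Types (e d g y : 'M[R]_(m, n)).

Definition lyapunov (B : 'M[R]_m) (L : R) e y : R :=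
  4 * L * fdot e e - fdot e (B *m e) + fdot y (B *m y).

(** The decrease pays for [delta] times the new value: [mu |e'|^2] covers the distance part, and the
    terms in [g] and [d] cover the potential part, through [By2] and the bound by [lam]. *)
Lemma lyapunov_contract (B : 'M[R]_m) (L mu lam delta : R) e e' g y :
  B^T = B ->
  (forall X : 'M[R]_(m, n), 0 <= fdot X (B *m X)) ->
  (forall X : 'M[R]_(m, n), fdot X (B *m X) <= L * fdot X X) ->
  (forall X : 'M[R]_(m, n), fdot (B *m X) (B *m X) <= L * fdot X (B *m X)) ->
  (forall X : 'M[R]_(m, n), lam * fdot X (B *m X) <= fdot (B *m X) (B *m X)) ->
  0 < L -> 0 < delta -> delta * (4 * L) <= mu -> delta * (16 * L) <= lam ->
  mu * fdot e' e' + L^-1 * fdot g g - L * fdot (e' - e) (e' - e) <= 2 * fdot e' g ->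
  (4 * L) *: (e' - e) = - (g + B *m y + B *m e) ->
  (1 + delta) * lyapunov B L e' (y + e') <= lyapunov B L e y.
Proof.
move=> symB B0 BL B2 Blam L0 d0 dmu dlam.
have [d dE] : exists d, d = e' - e by exists (e' - e).
have -> : e = e' - d by rewrite dE subKr.
rewrite subKr => Hg Hstep.
have gE : g = - ((4 * L) *: d + B *m y + B *m e' - B *m d).
  rewrite Hstep mulmxBr; move: (B *m y) (B *m e') (B *m d) => a b c.
  by apply/matrixP => i j; rewrite !mxE; ring.
have ByE : B *m (y + e') = - (g + ((4 * L) *: d - B *m d)).
  rewrite gE mulmxDr; move: (B *m y) (B *m e') (B *m d) => a b c.
  by apply/matrixP => i j; rewrite !mxE; ring.
have sB (X Y : 'M[R]_(m, n)) : fdot X (B *m Y) = fdot Y (B *m X).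
  by rewrite -[LHS](fdot_mulmx _ _ _ symB) fdotC.
have balance : lyapunov B L e' (y + e') + (4 * L * fdot d d - fdot d (B *m d))
    + fdot e' (B *m e') + 2 * fdot e' g = lyapunov B L (e' - d) y.
  rewrite gE /lyapunov !(mulmxDr, mulmxN) !fdotE (sB y e') (sB d e') (fdotC d e'); ring.
(* Here [B y' = - (g + h)] with [h = M d], so [|B y'|^2 <= 2 |g|^2 + 2 |h|^2], and
   [|M d|^2 <= 4 L <d, M d>] because [B^2 <= L B]. *)
have By2 : fdot (B *m (y + e')) (B *m (y + e')) <=
    2 * fdot g g + 8 * L * (4 * L * fdot d d - fdot d (B *m d)).
  have [h hE] : exists h, h = (4 * L) *: d - B *m d by exists ((4 * L) *: d - B *m d).
  have hh : fdot h h <= 4 * L * (4 * L * fdot d d - fdot d (B *m d)).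
    have := B2 d; have : 0 <= L * fdot d (B *m d) by apply: mulr_ge0 => //; exact: ltW.
    by rewrite hE !fdotE (fdotC (B *m d) d); lra.
  have := fdot_ge0 (g - h).
  by rewrite ByE -hE !fdotE !(fdotC h g); lra.
have := Blam (y + e'); have := B0 (y + e'); have := B0 e'; have := BL d.
have := fdot_ge0 d; have := fdot_ge0 e'; have := fdot_ge0 g; move: By2.
move: balance; rewrite {1 3}/lyapunov.
move: (lyapunov _ _ _ y) (fdot (B *m (y + e')) _) (fdot (y + e') _)
  (fdot e' (B *m e')) (fdot d (B *m d)) Hg => V1 By2 yy eB dB.
move: (fdot d d) (fdot e' e') (fdot g g) (2 * fdot e' g) => dd ee gg eg.
move=> Hg bal h1 h2 h3 h4 h5 h6 h7 h8.
(* The factor [16 L] leaves half of [<d, M d>] on the right. The decrease provides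
   [<d, M d> - L |d|^2], which is at least that half since [<d, B d> <= L |d|^2]. *)
have k1 : delta * yy <= (16 * L)^-1 * (2 * gg + 8 * L * (4 * L * dd - dB)).
  rewrite [leRHS]mulrC ler_pdivlMr ?mulr_gt0 //; apply: le_trans (le_trans h8 h1).
  by rewrite mulrAC ler_wpM2r.
have k2 : (16 * L)^-1 * (2 * gg + 8 * L * (4 * L * dd - dB)) =
   8^-1 * (L^-1 * gg) + 2^-1 * (4 * L * dd - dB) by field; rewrite gt_eqF.
have k3 : delta * (4 * L * ee) <= mu * ee by rewrite mulrA ler_wpM2r.
have k4 : 0 <= L^-1 * gg by rewrite mulr_ge0 // invr_ge0 ltW.
have k5 : 0 <= delta * eB by rewrite mulr_ge0 // ltW.
have k6 : 0 <= L * dd by rewrite mulr_ge0 // ltW.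
rewrite mulrDl mul1r mulrDr mulrBr; lra.
Qed.
End Lyapunov.

(** * Spectral properties of [1 - W] *)

Section Gossip.
Context {R : realType} {m n : nat} {edge : rel 'I_m} {W : 'M[R]_m}.
Hypothesis (m0 : (0 < m)%N) (wW : weight_matrix edge W).
Implicit Types X Y : 'M[R]_(m, n).

Lemma lap_sym : (1%:M - W)^T = 1%:M - W.
Proof. by rewrite linearB /= trmx1 (weight_sym wW). Qed.

Lemma ones_lap : const_mx 1 *m (1%:M - W) = 0 :> 'rV[R]_m.
Proof.
apply: trmx_inj; rewrite trmx_mul lap_sym trmx_const mulmxBl mul1mx.
by rewrite (weight_const wW) subrr trmx0.
Qed.

Lemma lap_consensus (u : 'rV[R]_n) : (1%:M - W) *m (\matrix_(i < m) u) = 0.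
Proof.
have -> : \matrix_(i < m) u = const_mx 1 *m u.
  by apply/matrixP => i j; rewrite !mxE big_ord1 !mxE mul1r.
by rewrite mulmxA -[X in X *m u]trmxK trmx_mul lap_sym trmx_const ones_lap trmx0 mul0mx.
Qed.

(** With [N = 1 - W] and [t = 1 - sigma2 W], [N >= t] on the complement of the constants gives
    [N^2 >= t N] there; the constants lie in the kernel of [N]. *)
Lemma lap_gap (u : 'rV[R]_m) :
  (1 - sigma2 W) * inner u (u *m (1%:M - W)) <=
  inner (u *m (1%:M - W)) (u *m (1%:M - W)).
Proof.
set N := 1%:M - W; set ones : 'rV[R]_m := const_mx 1.
have oo : inner ones ones = m%:R by exact: inner_ones.
have mn0 : m%:R != 0 :> R by rewrite pnatr_eq0 -lt0n.
set c := m%:R^-1 * inner u ones.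
have [p pE] : exists p, p = u - c *: ones by exists (u - c *: ones).
have uE : u = p + c *: ones by rewrite pE subrK.
have po : inner p ones = 0.
  by rewrite pE !innerE oo /c mulrAC mulVf // mul1r subrr.
have uN : u *m N = p *m N by rewrite uE mulmxDl -scalemxAl ones_lap scaler0 addr0.
have oN : inner ones (p *m N) = 0.
  by rewrite innerC inner_mulmx lap_sym ones_lap inner0r.
have -> : inner u (u *m N) = inner p (p *m N) by rewrite uN uE !innerE oN mulr0 addr0.
rewrite uN.
have gap : (1 - sigma2 W) * inner p p <= inner p (p *m N).
  have := sigma2_gap W p m0 wW po.
  by rewrite /N mulmxBr mulmx1 innerDr innerNr; lra.
have s1 : 0 <= 1 - sigma2 W by have := weight_sigma2 wW; lra.
(* Expanding this square and using [t^2 |p|^2 <= t <p, p N>], with [t = 1 - sigma2 W], yields the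
   claim. *)
have := inner_ge0 (p *m N - (1 - sigma2 W) *: p).
rewrite !innerE (innerC (p *m N) p).
have := ler_wpM2l s1 gap; lra.
Qed.

Lemma lap_gap_fdot X :
  (1 - sigma2 W) * fdot X ((1%:M - W) *m X) <=
  fdot ((1%:M - W) *m X) ((1%:M - W) *m X).
Proof.
rewrite !fdot_trE mulr_sumr; apply: ler_sum => j _.
by rewrite row_tr_mulmx lap_sym lap_gap.
Qed.

Lemma weight_fdot_le X : fdot (W *m X) (W *m X) <= fdot X X.
Proof.
have sW (Y Z : 'M[R]_(m, n)) : fdot Y (W *m Z) = fdot (W *m Y) Z.
  by rewrite fdot_mulmx ?(weight_sym wW).
(* [2 (1 - W^2) = (1 - W) (1 + W) (1 - W) + (1 + W) (1 - W) (1 + W)] *)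
have := psd_fdot _ ((1%:M - W) *m X) (weight_geN1 wW).
have := psd_fdot _ ((W + 1%:M) *m X) (weight_le1 wW).
rewrite !(mulmxDl, mulmxDr, mulmxBl, mulmxBr, mulNmx, mulmxN, mul1mx) !fdotE.
rewrite !(sW X) !(fdotC _ X) !(fdotC _ (W *m X)); lra.
Qed.

Lemma lap_range (G : 'M[R]_(m, n)) :
  (const_mx 1 : 'rV[R]_m) *m G = 0 -> exists Y, (1%:M - W) *m Y = G.
Proof.
move=> oG; set N := 1%:M - W; set ones : 'rV[R]_m := const_mx 1.
have mn0 : m%:R != 0 :> R by rewrite pnatr_eq0 -lt0n.
have oo : ones *m ones^T = m%:R%:M.
  rewrite [LHS]mx11_scalar -inner_trE; congr _%:M; exact: inner_ones.
(* Adding a positive multiple of the projection on the constants makes [N]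
   invertible without changing it on their complement. *)
set K := N + ones^T *m ones.
have Ku : K \in unitmx.
  rewrite -row_free_unit; apply: inj_row_free => v vK.
  have vKE : v *m K = v *m N + inner v ones *: ones.
    by rewrite mulmxDr mulmxA [v *m ones^T]mx11_scalar mul_scalar_mx inner_trE.
  have : inner v (v *m K) = 0 by rewrite vK inner0r.
  rewrite vKE !innerE => H.
  have vN : 0 <= inner v (v *m N).
    by have := (weight_le1 wW).2 v; rewrite -inner_trE innerC.
  (* Both nonnegative terms of [H] vanish: [v] is orthogonal to the constants, and the spectral gap
     then forces [v = 0]. *)
  have vo : inner v ones = 0.
    by apply/eqP; rewrite -sqrf_eq0 expr2 eq_le -expr2 sqr_ge0 andbT expr2; lra.
  have := sigma2_gap W v m0 wW vo; have := inner_ge0 v; have := weight_sigma2 wW.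
  move: H; rewrite vo mulr0 addr0 /N mulmxBr mulmx1 !innerE => H s1 vv gap.
  apply/eqP; rewrite -inner_eq0 eq_le vv andbT -(@ler_pM2l _ (1 - sigma2 W)) ?subr_gt0 //; lra.
exists (invmx K *m G).
have KY : K *m (invmx K *m G) = G by rewrite mulKVmx.
have oY : ones *m (invmx K *m G) = 0.
  have := congr1 (mulmx ones) KY; rewrite oG /K mulmxDl mulmxDr mulmxA ones_lap mul0mx add0r.
  rewrite !mulmxA oo -!mulmxA mul_scalar_mx => /eqP; rewrite scaler_eq0 (negbTE mn0) /= => /eqP //.
by move: KY; rewrite {1}/K mulmxDl -mulmxA oY mulmx0 addr0.
Qed.
End Gossip.

(** * Averages over the agents and optimality of the minimizer *)

Section Averages.
Context {R : realType} {m n : nat}.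
Hypothesis m0 : (0 < m)%N.

(** Cross terms vanish because deviations from the mean sum to zero. With [u] the minimizer, one
    distance bound controls both the consensus error and the error of the average. *)
Lemma mean_variance (x : 'M[R]_(m, n)) (u : 'rV[R]_n) :
  m%:R^-1 * \sum_(i < m) inner (row i x - u) (row i x - u) =
  m%:R^-1 * \sum_(i < m) inner (row i x - avg_row x) (row i x - avg_row x)
  + inner (avg_row x - u) (avg_row x - u).
Proof.
have mn0 : m%:R != 0 :> R by rewrite pnatr_eq0 -lt0n.
set a := avg_row x.
have sum0 : \sum_(i < m) inner (row i x - a) (a - u) = 0.
  rewrite (eq_bigr (fun i => inner (row i x) (a - u) - inner a (a - u))); last first.
    by move=> i _; rewrite innerDl innerNl.
  rewrite sumrB sumr_const card_ord -inner_suml.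
  have -> : \sum_(i < m) row i x = m%:R *: a by rewrite /a /avg_row scalerA mulfV // scale1r.
  by rewrite innerZl mulr_natl subrr.
rewrite (eq_bigr (fun i => inner (row i x - a) (row i x - a)
   + (2 * inner (row i x - a) (a - u) + inner (a - u) (a - u)))); last first.
  move=> i _; have -> : row i x - u = (row i x - a) + (a - u) by rewrite addrA subrK.
  move: (row i x - a) (a - u) => v w; rewrite !innerE (innerC w v); ring.
rewrite !big_split /= -mulr_sumr sum0 mulr0 add0r sumr_const card_ord -[inner _ _ *+ m]mulr_natl.
by rewrite mulrDr mulrA mulVf // mul1r.
Qed.

Context (f : 'I_m -> 'rV[R]_n -> R) (L : R) (xs : 'rV[R]_n).
Hypotheses (smf : forall i, smooth L (f i)).

Lemma smooth_sum y : \sum_(i < m) f i y <= \sum_(i < m) f i xs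
  + inner (\sum_(i < m) grad (f i) xs) (y - xs) + m%:R * (L / 2 * inner (y - xs) (y - xs)).
Proof.
rewrite inner_suml.
have -> : m%:R * (L / 2 * inner (y - xs) (y - xs)) =
     \sum_(i < m) (L / 2 * inner (y - xs) (y - xs)).
  by rewrite sumr_const card_ord mulr_natl.
rewrite -!big_split /=; apply: ler_sum => i _.
by have := smf i xs y; rewrite enorm_sqr.
Qed.

Hypotheses (L0 : 0 < L) (minf : minimizer (avg_fun f) xs).

(** The sum of the [f i] is [m L]-smooth, so a gradient step of length [t = 1 / (m L)] from [xs]
    would lower it by at least [t / 2 * |S|^2]. *)
Lemma sum_grad_minimizer : \sum_(i < m) grad (f i) xs = 0.
Proof.
set S := \sum_(i < m) _.
have mp : 0 < m%:R :> R by rewrite ltr0n.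
have := minf (xs - (m%:R * L)^-1 *: S); rewrite /avg_fun ler_pM2l ?invr_gt0 // => h.
have := le_trans h (smooth_sum _).
rewrite -/S [xs - _ - xs]addrAC subrr sub0r !(innerNl, innerNr, innerZl, innerZr).
set t := (m%:R * L)^-1.
have -> : m%:R * (L / 2 * - - (t * (t * inner S S))) = t / 2 * inner S S.
  by rewrite /t; field; rewrite !gt_eqF.
have t0 : 0 < t by rewrite invr_gt0 mulr_gt0.
have := inner_ge0 S => SS H.
apply/eqP; rewrite -inner_eq0 eq_le SS andbT -(@ler_pM2l _ t) //; lra.
Qed.

Lemma avg_fun_gap y : avg_fun f y - avg_fun f xs <= L / 2 * inner (y - xs) (y - xs).
Proof.
have mp : 0 < m%:R :> R by rewrite ltr0n.
have := smooth_sum y; rewrite sum_grad_minimizer inner0l.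
move=> h; rewrite /avg_fun -mulrBr [leLHS]mulrC ler_pdivrMr //; lra.
Qed.
End Averages.

(** * Linear convergence of EXTRA *)

Section Convergence.
Context {R : realType} {m n : nat} {edge : rel 'I_m} {W : 'M[R]_m}.
Context {f : 'I_m -> 'rV[R]_n -> R} {mu L : R} (x0 : 'M[R]_(m, n)) {xs : 'rV[R]_n}.
Hypotheses (m0 : (0 < m)%N) (wW : weight_matrix edge W) (mu0 : 0 < mu) (L0 : 0 < L).
Hypotheses (scf : forall i, strongly_convex mu (f i)) (smf : forall i, smooth L (f i)).
Hypothesis minf : minimizer (avg_fun f) xs.

Let B : 'M[R]_m := (L / 2) *: (1%:M - W).
Let Xs : 'M[R]_(m, n) := \matrix_(i < m) xs.
Let gap : R := 1 - sigma2 W.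
Let lam : R := L / 2 * gap.
Let state k := extra f W (2 * (L + L))^-1 L x0 0 k.

(** The largest [delta] allowed by [lyapunov_contract]: [delta * (16 * L) <= lam = L / 2 * gap] and
    [delta * (4 * L) <= mu]. *)
Definition rate : R := Num.min (gap / 32) (mu / (4 * L)).

Let L2 : 0 < L / 2. Proof. by rewrite divr_gt0. Qed.
Let gap0 : 0 < gap. Proof. by rewrite subr_gt0 (weight_sigma2 wW). Qed.
Let lam0 : 0 < lam. Proof. by rewrite mulr_gt0. Qed.

Lemma rate_gt0 : 0 < rate.
Proof. by rewrite lt_min !divr_gt0 ?mulr_gt0. Qed.

Let BE (X : 'M[R]_(m, n)) : B *m X = (L / 2) *: ((1%:M - W) *m X).
Proof. by rewrite -scalemxAl. Qed.

Let B_sym : B^T = B. Proof. by rewrite linearZ /= (lap_sym wW). Qed.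

Let B_ge0 (X : 'M[R]_(m, n)) : 0 <= fdot X (B *m X).
Proof.
by rewrite BE fdotZr mulr_ge0 ?(psd_fdot _ _ (weight_le1 wW)) // ltW.
Qed.

Let B_le (X : 'M[R]_(m, n)) : fdot X (B *m X) <= L * fdot X X.
Proof.
have := psd_fdot _ X (weight_geN1 wW).
rewrite BE fdotZr mulmxBl mulmxDl mul1mx !fdotE => h.
have := mulr_ge0 (ltW L2) h; lra.
Qed.

Let B_sqr_le (X : 'M[R]_(m, n)) : fdot (B *m X) (B *m X) <= L * fdot X (B *m X).
Proof.
have := weight_fdot_le wW X.
rewrite BE mulmxBl mul1mx !fdotE (fdotC (W *m X) X) => h.
have := mulr_ge0 (ltW L2) (ltW L2).
rewrite -subr_ge0 in h; move=> h'; have := mulr_ge0 h' h; lra.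
Qed.

Let B_gap (X : 'M[R]_(m, n)) : lam * fdot X (B *m X) <= fdot (B *m X) (B *m X).
Proof.
have := lap_gap_fdot m0 wW X; rewrite BE !fdotE /lam -/gap => h.
by rewrite -mulrA ler_pM2l // mulrCA ler_pM2l.
Qed.

Let B_Xs : B *m Xs = 0.
Proof. by rewrite BE (lap_consensus wW) scaler0. Qed.

Let row_Xs i : row i Xs = xs. Proof. by rewrite rowK. Qed.

Let descent (x x' : 'M[R]_(m, n)) :
  mu * fdot (x' - Xs) (x' - Xs)
    + L^-1 * fdot (stacked_grad f x - stacked_grad f Xs) (stacked_grad f x - stacked_grad f Xs)
    - L * fdot (x' - x) (x' - x) <=
  2 * fdot (x' - Xs) (stacked_grad f x - stacked_grad f Xs).
Proof.
rewrite /fdot !mulr_sumr -sumrN -!big_split /=; apply: ler_sum => i _.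
rewrite !linearB /= !rowK; exact: (descent_bound _ _ _ mu0 L0 (scf i) (smf i)).
Qed.

(* [y] is the dual variable in potential form, [v = v_star + B y] with
   [v_star = - stacked_grad f Xs]. *)
Lemma extra_contract y0 k : B *m y0 = stacked_grad f Xs -> exists y,
  (state k).2 = - stacked_grad f Xs + B *m y /\
  (1 + rate) ^+ k * lyapunov B L ((state k).1 - Xs) y <= lyapunov B L (x0 - Xs) y0.
Proof.
move=> y0E; elim: k => [|k [y [vE IH]]].
  (* The start [v^0 = 0] is [v_star + B y0]. *)
  by exists y0; rewrite y0E addNr expr0 mul1r.
exists (y + ((state k.+1).1 - Xs)).
have : state k.+1 = extra_step f W (2 * (L + L))^-1 L (state k) by [].
move: vE IH; case: (state k) => x v /= -> IH ->; rewrite /= -!BE.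
move x'E: (x - _) => x'.
have dE : x' - Xs - (x - Xs) = x' - x by rewrite opprB addrA subrK.
split; first by rewrite mulmxDr mulmxBr B_Xs subr0 addrA.
apply: le_trans IH; rewrite exprSr -mulrA ler_wpM2l ?exprn_ge0 ?addr_ge0 ?(ltW rate_gt0) //.
apply: (lyapunov_contract _ _ mu lam _ _ _ (stacked_grad f x - stacked_grad f Xs)) => //.
- exact: rate_gt0.
- by rewrite -ler_pdivlMr ?mulr_gt0 // ge_min lexx orbT.
- rewrite -ler_pdivlMr ?mulr_gt0 // ge_min; apply/orP; left.
  by rewrite /lam le_eqVlt; apply/orP; left; apply/eqP; field; rewrite gt_eqF.
- by rewrite dE; exact: descent.
- rewrite dE mulmxBr B_Xs subr0 -x'E addrC addKr scalerN scalerA.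
  have -> : 2 * (L + L) = 4 * L by ring.
  by rewrite mulfV ?gt_eqF ?mulr_gt0 // scale1r addrA.
Qed.

(** The factor [4 / 3] compares the initial value, at most [4 m (L R1 + R2 / L) / gap], with the
    lower bound [3 L |x - x_star|^2] of the Lyapunov function, which follows from [B <= L]. *)
Lemma extra_linear_rate (R1 R2 : R) :
  (forall i, enorm (row i x0 - xs) ^+ 2 <= R1) ->
  (forall i, enorm (grad (f i) xs) ^+ 2 <= R2) ->
  forall k, (1 + rate) ^+ k *
    (L * (m%:R^-1 * \sum_(i < m) inner (row i (state k).1 - xs) (row i (state k).1 - xs)))
  <= 4 / 3 * ((L * R1 + R2 / L) / gap).
Proof.
move=> hR1 hR2 k.
have mp : 0 < m%:R :> R by rewrite ltr0n.
have s0 : gap <= 1 by rewrite /gap gerBl sigma2_ge0.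
have oG : (const_mx 1 : 'rV[R]_m) *m ((L / 2)^-1 *: stacked_grad f Xs) = 0.
  rewrite -scalemxAr (_ : _ *m _ = \sum_(i < m) grad (f i) xs).
    by rewrite (sum_grad_minimizer m0 _ _ _ smf L0 minf) scaler0.
  apply/rowP => j; rewrite !mxE summxE; apply: eq_bigr => i _.
  by rewrite !mxE mul1r row_Xs.
have [y0 y0E] := lap_range m0 wW _ oG.
have By0 : B *m y0 = stacked_grad f Xs by rewrite BE y0E scalerA mulfV ?scale1r // gt_eqF.
have [y [_ HV]] := extra_contract _ k By0.
have rows (x : 'M[R]_(m, n)) : fdot (x - Xs) (x - Xs) =
    \sum_(i < m) inner (row i x - xs) (row i x - xs).
  by apply: eq_bigr => i _; rewrite linearB /= row_Xs.
have V0 : lyapunov B L (x0 - Xs) y0 <= m%:R * (4 * (L * R1 + R2 / L) / gap).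
  have e0 : fdot (x0 - Xs) (x0 - Xs) <= m%:R * R1.
    rewrite rows -[m in m%:R]card_ord mulr_natl -sumr_const; apply: ler_sum => i _.
    by rewrite -enorm_sqr.
  have g0 : fdot (B *m y0) (B *m y0) <= m%:R * R2.
    rewrite By0 -[m in m%:R]card_ord mulr_natl -sumr_const; apply: ler_sum => i _.
    by rewrite !rowK -enorm_sqr.
  (* The potential [y0] itself has no direct bound; the spectral gap replaces it by [B y0], the
     gradient at the minimizer. *)
  have yB : fdot y0 (B *m y0) <= m%:R * R2 / lam.
    by rewrite ler_pdivlMr // mulrC; apply: le_trans g0; exact: B_gap.
  have R10 : 0 <= R1 by apply: le_trans (hR1 (Ordinal m0)); rewrite sqr_ge0.
  have R20 : 0 <= R2 by apply: le_trans (hR2 (Ordinal m0)); rewrite sqr_ge0.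
  have q1 : L * R1 <= L * R1 / gap.
    by apply: ler_peMr; [rewrite mulr_ge0 // ltW | rewrite invf_ge1].
  have q2 : m%:R * R2 / lam = 2 * (m%:R * (R2 / L / gap)) by rewrite /lam; field; rewrite !gt_eqF.
  have q3 : 0 <= m%:R * (R2 / L / gap).
    by apply: mulr_ge0; [exact: ltW | rewrite divr_ge0 ?(divr_ge0, ltW L0, ltW gap0)].
  have q4 := ler_wpM2l (ltW L0) e0.
  have q5 := ler_wpM2l (ltW mp) q1.
  have -> : 4 * (L * R1 + R2 / L) / gap = 4 * (L * R1 / gap) + 4 * (R2 / L / gap) by ring.
  have := B_ge0 (x0 - Xs); rewrite /lyapunov; lra.
have Vk : 3 * L * fdot ((state k).1 - Xs) ((state k).1 - Xs) <= lyapunov B L ((state k).1 - Xs) y.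
  by have := B_le ((state k).1 - Xs); have := B_ge0 y; rewrite /lyapunov; lra.
have rk : 0 <= (1 + rate) ^+ k by rewrite exprn_ge0 // addr_ge0 // ltW // rate_gt0.
have := le_trans (ler_wpM2l rk Vk) (le_trans HV V0); rewrite rows.
move: (_ ^+ k) (\sum_(i < m) _) => r S h.
rewrite -(@ler_pM2l _ (3 * m%:R)) ?mulr_gt0 //.
have -> : 3 * m%:R * (r * (L * (m%:R^-1 * S))) = r * (3 * L * S) by field; rewrite gt_eqF.
by apply: le_trans h _; rewrite le_eqVlt; apply/orP; left; apply/eqP; field; rewrite !gt_eqF.
Qed.
End Convergence.

(** * From the linear rate to the number of iterations *)

Section IterationCount.
Context {R : realType}.

(** Since [1 + delta >= expR (delta / 2)], it suffices that [k * delta / 2 >= 96 * K * l * delta >=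
    3 * l]. *)
Lemma expR_cube_le_geometric (delta l K : R) (k : nat) :
  0 < delta -> delta <= 1 -> 0 <= l -> 1 <= 32 * (K * delta) ->
  192 * (K * l) <= k%:R -> expR l ^+ 3 <= (1 + delta) ^+ k.
Proof.
move=> d0 d1 l0 Kd hk.
(* From [expR (- (delta / 2)) >= 1 - delta / 2] and [(1 + delta) * (1 - delta / 2) >= 1], which
   holds for [delta <= 1]. *)
have dexp : expR (delta / 2) <= 1 + delta.
  have := expR_ge1Dx (- (delta / 2)); rewrite expRN => h.
  have ep := expR_gt0 (delta / 2).
  have : expR (delta / 2) * (1 - delta / 2) <= 1.
    by rewrite mulrC -ler_pdivlMr // div1r.
  have : 0 <= expR (delta / 2) by rewrite ltW.
  nra.
apply: le_trans (_ : expR (delta / 2) ^+ k <= _); last first.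
  by apply: lerXn2r => //; rewrite nnegrE ?expR_ge0 //; lra.
rewrite -!expRM_natl ler_expR.
have := ler_wpM2r (ltW d0) hk; have := ler_wpM2r l0 Kd.
lra.
Qed.
End IterationCount.

(* Fails for [n = 0], where every [mu] and [L] are admissible. *)
Lemma strong_le_smooth {R : realType} {n : nat} (f : 'rV[R]_n -> R) (mu L : R) :
  (0 < n)%N -> strongly_convex mu f -> smooth L f -> mu <= L.
Proof.
move=> n0 sc sm; pose d : 'rV[R]_n := delta_mx 0 (Ordinal n0).
have dd : 0 < inner d d.
  rewrite lt_neqAle inner_ge0 eq_sym inner_eq0 andbT; apply/eqP => /rowP/(_ (Ordinal n0)).
  by rewrite !mxE !eqxx => /eqP; rewrite oner_eq0.
have := le_trans (sc 0 d) (sm 0 d).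
by rewrite lerD2l enorm_sqr subr0 ler_pM2r //; lra.
Qed.

Theorem corollary1 (R : realType) (R1 R2 : R) (hR1 : 0 < R1) (hR2 : 0 < R2) :
  exists C eps0 : R, 0 < C /\ 0 < eps0 /\
  forall (m n : nat) (e : rel 'I_m) (f : 'I_m -> 'rV[R]_n -> R)
    (W : 'M[R]_m) (mu L : R) (x0 : 'M[R]_(m, n)) (xs : 'rV[R]_n),
  (0 < m)%N ->
  symmetric e -> irreflexive e ->
  (forall (i : 'I_m) (x : 'rV[R]_n), differentiable (f i) x) ->
  0 < mu ->
  (forall i : 'I_m, strongly_convex mu (f i)) ->
  (forall i : 'I_m, smooth L (f i)) ->
  weight_matrix e W ->
  minimizer (avg_fun f) xs ->
  (forall i : 'I_m, enorm (row i x0 - xs) ^+ 2 <= R1) ->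
  enorm xs ^+ 2 <= R1 ->
  (forall i : 'I_m, enorm (grad (f i) xs) ^+ 2 <= R2) ->
  forall eps : R, 0 < eps -> eps <= eps0 ->
  forall k : nat,
  C * ((L / mu + (1 - sigma2 W)^-1)
       * ln ((L * R1 + R2 / L) / (eps * (1 - sigma2 W)))) <= k%:R ->
  let beta := L in
  let alpha := (2 * (L + beta))^-1 in
  let x := (extra f W alpha beta x0 0 k).1 in
  avg_fun f (avg_row x) - avg_fun f xs <= eps /\
  m%:R^-1 * \sum_(i < m) enorm (row i x - avg_row x) ^+ 2 <= eps ^+ 2.
Proof.
(* As [K * rate >= 1 / 32] for [K = L / mu + 1 / gap], the constant [192 = 3 * 64]
   makes [(1 + rate) ^ k] exceed the cube of [Lam = A / (eps gap)], where
   [A = L R1 + R2 / L >= sqrt (R1 R2)]; the cube absorbs both the [eps ^ 2] and the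
   factor [1 / L <= A / R2], and [eps0] makes [Lam >= 1 + 2 / R2]. *)
have T0 : 0 < 1 + 2 / R2 by rewrite addr_gt0 // divr_gt0.
exists 192, (Num.sqrt (R1 * R2) / (1 + 2 / R2)); split => //; split.
  by rewrite divr_gt0 // sqrtr_gt0 mulr_gt0.
move=> m n edge f W mu L x0 xs m0 _ _ _ mu0 sc sm wW minf hx0 _ hg eps eps0 epsle k hk beta alpha x.
(* In dimension zero both errors vanish; in positive dimension [mu <= L] gives [L > 0]. *)
have [n0|n0] := posnP n.
  subst n; split; first by rewrite (thinmx0 (avg_row x)) (thinmx0 xs) subrr ltW.
  rewrite big1 ?mulr0 ?sqr_ge0 // => i _.
  by rewrite thinmx0 enorm_sqr /inner big_ord0.
have L0 : 0 < L by apply: lt_le_trans (strong_le_smooth _ _ _ n0 (sc (Ordinal m0)) (sm _)).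
have := extra_linear_rate x0 m0 wW mu0 L0 sc sm minf R1 R2 hx0 hg k.
set gap := 1 - sigma2 W in hk *; set A := L * R1 + R2 / L in hk *.
have gap0 : 0 < gap by rewrite subr_gt0 (weight_sigma2 wW).
have gap1 : gap <= 1 by rewrite gerBl sigma2_ge0.
set Lam := A / (eps * gap) in hk.
have A0 : 0 < A by rewrite addr_gt0 ?divr_gt0 ?mulr_gt0.
have Asqrt : Num.sqrt (R1 * R2) <= A.
  rewrite -(@ler_pXn2r _ 2) ?nnegrE ?sqrtr_ge0 ?ltW // sqr_sqrtr ?mulr_ge0 ?ltW //.
  have : 0 <= (L * R1) ^+ 2 + (R2 / L) ^+ 2 by rewrite addr_ge0 ?sqr_ge0.
  have e1 : (L * R1) * (R2 / L) = R1 * R2 by field; rewrite gt_eqF.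
  have : 0 < R1 * R2 by rewrite mulr_gt0.
  rewrite /A; move: e1; nra.
have LamT : 1 + 2 / R2 <= Lam.
  rewrite ler_pdivlMr ?mulr_gt0 //; apply: le_trans Asqrt.
  rewrite -ler_pdivlMl // [leRHS]mulrC; apply: le_trans epsle.
  by rewrite -[leRHS]mulr1 ler_wpM2l // ltW.
have R2inv : 0 < R2^-1 by rewrite invr_gt0.
have Lam1 : 1 <= Lam by lra.
have Lam0 : 0 < Lam by lra.
set S := m%:R^-1 * \sum_(i < m) _; set delta := rate => hS.
have d0 : 0 < delta by exact: (rate_gt0 wW mu0 L0).
have pow : Lam ^+ 3 <= (1 + delta) ^+ k.
  rewrite -[Lam]lnK ?posrE //; apply: expR_cube_le_geometric hk => //.
  - rewrite /delta /rate ge_min; apply/orP; left; rewrite -/gap; lra.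
  - exact: ln_ge0.
  - have Lmu : 0 < L / mu by rewrite divr_gt0.
    have gi : 0 < gap^-1 by rewrite invr_gt0.
    rewrite /delta /rate minEle -/gap; case: ifP => _.
      have -> : 32 * ((L / mu + gap^-1) * (gap / 32)) = 1 + L / mu * gap by field; rewrite !gt_eqF.
      by rewrite lerDl mulr_ge0 ?ltW.
    have -> : 32 * ((L / mu + gap^-1) * (mu / (4 * L))) =
        8 + 8 * (gap^-1 * (mu / L)) by field; rewrite !gt_eqF.
    have : 0 < gap^-1 * (mu / L) by rewrite mulr_gt0 // divr_gt0.
    lra.
have S0 : 0 <= S.
  by rewrite mulr_ge0 ?invr_ge0 // sumr_ge0 // => i _; exact: inner_ge0.
(* One of the three factors [Lam] cancels [A / gap] up to [eps]. *)
have LS : L * S * Lam ^+ 2 <= 4 / 3 * eps.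
  rewrite -(@ler_pM2r _ Lam) //.
  have -> : L * S * Lam ^+ 2 * Lam = L * S * Lam ^+ 3 by ring.
  have -> : 4 / 3 * eps * Lam = 4 / 3 * (A / gap) by rewrite /Lam; field; rewrite !gt_eqF.
  by apply: le_trans hS; rewrite mulrC ler_wpM2r // mulr_ge0 // ltW.
have := mean_variance m0 x xs; rewrite -/S => varE.
have var0 : 0 <= m%:R^-1 * \sum_(i < m) inner (row i x - avg_row x) (row i x - avg_row x).
  by rewrite mulr_ge0 ?invr_ge0 // sumr_ge0 // => i _; exact: inner_ge0.
have avg0 := inner_ge0 (avg_row x - xs).
have Lam2 : 1 <= Lam ^+ 2 by rewrite exprn_ege1.
split.
  (* The objective gap is at most [L * S / 2 <= 2 / 3 * eps]. *)
  apply: le_trans (avg_fun_gap m0 f L xs sm L0 minf _) _.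
  have LS0 : 0 <= L * S by rewrite mulr_ge0 // ltW.
  have : L * inner (avg_row x - xs) (avg_row x - xs) <= L * S by rewrite ler_pM2l //; lra.
  have := ler_peMr LS0 Lam2; lra.
rewrite (eq_bigr (fun i => inner (row i x - avg_row x) (row i x - avg_row x))); last first.
  by move=> i _; rewrite enorm_sqr.
apply: le_trans (_ : S <= _); first by lra.
have R2L : R2 <= L * (Lam * eps).
  have : R2 / L <= A by rewrite lerDr mulr_ge0 // ltW.
  have -> : A = Lam * eps * gap by rewrite /Lam; field; rewrite !gt_eqF.
  rewrite ler_pdivrMr // => h; apply: le_trans h _.
  by rewrite mulrC ler_pM2l // ler_piMr // mulr_ge0 // ltW.
have R2Lam : 2 <= R2 * Lam by rewrite -ler_pdivrMl // mulrC; lra.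
(* One more [Lam] is traded for [2 / R2]; then [R2 <= L * (Lam * eps)] supplies the second [eps] and
   cancels [L * Lam], leaving [S <= 2 / 3 * eps ^+ 2]. *)
have X1 : L * S * Lam * 2 <= 4 / 3 * eps * R2.
  have := ler_wpM2r (ltW hR2) LS.
  have : 0 <= L * S * Lam.
    by apply: mulr_ge0 (ltW Lam0); exact: mulr_ge0 (ltW L0) S0.
  move=> p; have := ler_wpM2l p R2Lam; lra.
have X2 := ler_wpM2l (mulr_ge0 (ler0n R 4) (ltW eps0)) R2L.
have LL : 0 < L * Lam by rewrite mulr_gt0.
have LLe := mulr_ge0 (ltW LL) (sqr_ge0 eps).
rewrite -(@ler_pM2l _ (L * Lam)) //; lra.
Qed.
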